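(* For a Tychonoff space $X$ the following assertions are equivalent: (1) $C_p(X)$ is separable and satisfies $( *_1)$; (2) $C_p(X)$ is separable and satisfies $( *_1)$ with respect to dense subspaces; (3) $C_p(X)$ is S-separable; (4) $C_p(X)$ is M-separable; (5) $iw(X)=\omega$ and every finite power of $X$ is Menger.
   Context: $C_p(X)$ is the set of continuous real-valued functions on $X$ with the topology of pointwise convergence. A space $Z$ is S-separable if for every sequence $(Y_n)_{n\in\mathbb{N}}$ of dense subspaces of $Z$ there exists a sequence $(F_n)$ such that each $F_n$ is a finite subset of $Y_n$ and for each finite collection $\mathcal{F}$ of nonempty open sets of $Z$ there exists $n$ with $U\cap F_n\neq\emptyset$ for all $U\in\mathcal{F}$. $Z$ is M-separable if for every sequence $(Y_n)$ of dense subspaces of $Z$ there exists a sequence $(F_n)$ with each $F_n$ a finite subset of $Y_n$ and $\bigcup_{n}F_n$ dense in $Z$. For a set $F\subseteq Z$, a neighbourhood $\mathcal{N}(F)$ of $F$ is a collection $\{U_x:x\in F\}$ where each $U_x$ is an open set of $Z$ containing $x$. $Z$ satisfies $( *_1)$ if for any finite $F\subseteq Z$ and any sequence $(Y_n)$ of subsets of $Z$ with $F\subseteq\bigcap_n\overline{Y_n}$ there exists a sequence $(F_n)$ such that each $F_n$ is a finite subset of $Y_n$ and for each neighbourhood $\mathcal{N}(F)$ of $F$ there exists $n$ with $U\cap F_n\neq\emptyset$ for all $U\in\mathcal{N}(F)$. $Z$ satisfies $( *_1)$ with respect to dense subspaces if the same holds for any finite $F\subseteq Z$ and any sequence $(Y_n)$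 of dense subspaces of $Z$. $iw(X)$ is the least weight of a Tychonoff topology on $X$ contained in the topology of $X$; with the usual convention that cardinal functions take infinite values, $iw(X)=\omega$ means that $X$ has a coarser Tychonoff topology with a countable base. A space $Z$ is Menger if for every sequence $(\mathcal{U}_n)$ of open covers of $Z$ there are finite $\mathcal{V}_n\subseteq\mathcal{U}_n$ such that $\bigcup_n\mathcal{V}_n$ covers $Z$. *)

(* Defs.v *)
From HB Require Import structures.
From mathcomp Require Import all_boot all_order all_algebra.
From mathcomp Require Import all_classical all_reals all_analysis.

Set Implicit Arguments.
Unset Strict Implicit.
Unset Printing Implicit Defensive.

Import numFieldNormedType.Exports.
Local Open Scope classical_set_scope.

Definition Cp (X : topologicalType) (R : realType) : Type := continuousType X R.

(* The pointwise topology is the one induced by the inclusion in the product. *)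
HB.instance Definition _ (X : topologicalType) (R : realType) :=
  Topological.copy (Cp X R)
    (initial_topology (fun f : continuousType X R => (f : {ptws X -> R}))).

Definition tychonoff_space (X : topologicalType) : Prop :=
  accessible_space X /\ completely_regular_space X.

Section SelectionPrinciples.
Variable Z : topologicalType.
Implicit Types (F : set Z) (Y E : nat -> set Z).

Definition separable_space : Prop := exists2 D : set Z, countable D & dense D.

Definition finite_selection Y E : Prop :=
  forall n, finite_set (E n) /\ E n `<=` Y n.

Definition S_separable : Prop :=
  forall Y, (forall n, dense (Y n)) ->
  exists2 E, finite_selection Y E &
    forall G : set (set Z), finite_set G ->
      (forall U, G U -> open U /\ U !=set0) ->
      exists n, forall U, G U -> U `&` E n !=set0.

Definition M_separable : Prop :=
  forall Y, (forall n, dense (Y n)) ->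
  exists2 E, finite_selection Y E & dense (\bigcup_n E n).

(* Only the values of [U] on [F] matter: [U] stands for the family
   [{U x : x in F}] of open sets with [x] in [U x]. *)
Definition neighbourhood_of F (U : Z -> set Z) : Prop :=
  forall x, F x -> open (U x) /\ U x x.

Definition star1_selection F Y : Prop :=
  exists2 E, finite_selection Y E &
    forall U : Z -> set Z, neighbourhood_of F U ->
      exists n, forall x, F x -> U x `&` E n !=set0.

Definition star1 : Prop :=
  forall F Y, finite_set F -> F `<=` \bigcap_n closure (Y n) ->
  star1_selection F Y.

Definition star1_dense : Prop :=
  forall F Y, finite_set F -> (forall n, dense (Y n)) ->
  star1_selection F Y.

Definition open_cover (C : set (set Z)) : Prop :=
  C `<=` open /\ \bigcup_(A in C) A = [set: Z].

Definition menger_space : Prop :=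
  forall C : nat -> set (set Z), (forall n, open_cover (C n)) ->
  exists2 V : nat -> set (set Z),
    forall n, finite_set (V n) /\ V n `<=` C n &
    \bigcup_n \bigcup_(A in V n) A = [set: Z].

End SelectionPrinciples.

(* [iw X = omega], cardinal functions taking infinite values only; [c] is a
   second topology on the carrier of [X]. *)
Definition iw_eq_omega (X : topologicalType) : Prop :=
  exists c : Topological.axioms_ X,
    let X' : topologicalType := Topological.Pack c in
    [/\ tychonoff_space X',
        forall U : set X, @open X' U -> @open X U
      & @second_countable X'].

(* Main.v *)
(* (4) => (5): if [C_n] are open covers of [X^k], let [Y_n] be the set of
   functions [f] such that the points of [X^k] with all [f (p i) < 1] are covered
   by finitely many members of [C_n]. The tube lemma puts a finite set of points
   in an open [U] whose power [U^k] is so covered, and a function can be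
   prescribed on the finite set and equal [1] off [U]; hence [Y_n] is dense. The
   finite parts of the [Y_n] given by M-separability have a dense union, which
   meets the open set of the functions that are [< 1] at all coordinates of a
   given point [p]: this covers [p].
   (5) => (1): Arhangel'skii's argument. For a finite set [F] of functions lying
   in the closure of every [Y_n], the sets
   [{p in X^k : |f (p i) - g_f (p i)| < 1/(n+1) for all i and all f in F}], with
   [g_f] in [Y_n], form an open cover of [X^k] for each [n]. *)
Require Import Defs.
From mathcomp Require Import all_boot all_order all_algebra.
From mathcomp Require Import all_classical all_reals all_analysis.
From mathcomp Require Import lra.
Import numFieldNormedType.Exports.
Import Order.TTheory GRing.Theory Num.Theory.

Set Implicit Arguments.
Unset Strict Implicit.
Unset Printing Implicit Defensive.

Local Open Scope classical_set_scope.
Local Open Scope ring_scope.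

(** * Basic open sets of products and of the pointwise topology *)

Lemma finite_bigcap_open (T : topologicalType) (I : Type) (D : set I)
    (F : I -> set T) :
  finite_set D -> (forall i, D i -> open (F i)) -> open (\bigcap_(i in D) F i).
Proof.
(* Gives the bare type [I] a choice structure, so that [D] can be listed by a sequence. *)
elim/Pchoice: I => I in D F *.
move=> /finite_seqP[s ->]; elim: s => [|i s IHs] oF.
  by rewrite set_nil bigcap_set0; exact: openT.
have -> : [set` i :: s] = i |` [set` s].
  by apply/seteqP; split=> j /=; rewrite inE;
    [case/predU1P; [left|right]|case=> [->|->]; rewrite ?eqxx ?orbT].
rewrite bigcap_setU bigcap_set1; apply: openI.
  by apply: oF; rewrite /= mem_head.
by apply: IHs => j js; apply: oF; rewrite /= inE js orbT.
Qed.

Section PointwiseTopology.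
Variables (I : choiceType) (T : topologicalType).
Implicit Types (f g : {ptws I -> T}) (s : seq I) (W : I -> set T).

(** The boxes around [f] generate a filter, and it suffices that this filter converges to [f]. The
    product topology is the supremum of those induced by the coordinates, so one coordinate is
    treated at a time. *)
Lemma ptws_nbhs_box f (A : set {ptws I -> T}) : nbhs f A ->
  exists s, exists2 W, forall i, open_nbhs (f i) (W i) &
    forall g, (forall i, i \in s -> W i (g i)) -> A g.
Proof.
pose D := [set sW : seq I * (I -> set T) |
  forall i, open_nbhs (f i) (sW.2 i)].
pose box (sW : seq I * (I -> set T)) : set {ptws I -> T} :=
  [set g | forall i, i \in sW.1 -> sW.2 i (g i)].
pose F := filter_from D box.
have FF : Filter F.
  apply: filter_from_filter.
    by exists ([::], fun=> setT) => i; split => //; exact: openT.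
  move=> [s W] [s' W'] /= DW DW'.
  exists (s ++ s', fun i => W i `&` W' i) => [i|g /= sg].
    by apply: open_nbhsI; [exact: DW|exact: DW'].
  by split=> i /= is_; have [] := sg i; rewrite // mem_cat is_ ?orbT.
suff FA : F --> f.
  by move=> /FA[[s W] DW sA]; exists s, W => // g sg; exact: sA.
apply/cvg_sup => i A' [_ [[B oB <-] Bf BA]].
exists ([:: i], fun j => if j == i then B else setT) => [j|g /= sg].
  by rewrite /=; case: eqP => [->|_]; split => //; exact: openT.
by apply: BA => /=; have := sg i; rewrite inE /= eqxx; exact.
Qed.

Lemma open_box s W : (forall i, open (W i)) ->
  open [set g : {ptws I -> T} | forall i, i \in s -> W i (g i)].
Proof.
move=> oW; rewrite (_ : mkset _ =
    \bigcap_(i in [set` s]) ((fun g : {ptws I -> T} => g i) @^-1` W i)) //.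
apply: finite_bigcap_open => [|i _]; first exact: finite_seq.
by apply: open_comp => // g _; exact: (@proj_continuous I (fun=> T) i).
Qed.

End PointwiseTopology.

Section PointwiseConvergence.
Variables (R : realType) (X : topologicalType).
Implicit Types (f g : Cp X R) (O : set (Cp X R)).

Lemma Cp_open_near O f : open O -> O f ->
  exists s : seq X, exists2 e : R, 0 < e &
    forall g, (forall x, x \in s -> `|g x - f x| < e) -> O g.
Proof.
move=> [B oB <-] Bf.
have [s [W fW sW]] := @ptws_nbhs_box X R _ _ (open_nbhs_nbhs (conj oB Bf)).
suff [e e0 eW] : exists2 e : R, 0 < e &
    forall x, x \in s -> forall y, `|y - f x| < e -> W x y.
  by exists s, e => // g gf; apply: sW => x xs; apply: (eW x) => //; exact: gf.
elim: s {sW} => [|x s [e e0 eW]]; first by exists 1.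
have /nbhs_ballP[d /= d0 dW] := open_nbhs_nbhs (fW x).
exists (Num.min d e); first by rewrite lt_min d0.
move=> z; rewrite inE => /orP[/eqP ->|zs] y; rewrite lt_min => /andP[yd ye].
  by apply: dW; rewrite /ball /= distrC.
exact: eW.
Qed.

Lemma open_Cp_box (s : seq X) (W : X -> set R) : (forall x, open (W x)) ->
  open [set g : Cp X R | forall x, x \in s -> W x (g x)].
Proof.
move=> oW.
exists [set g : {ptws X -> R} | forall x, x \in s -> W x (g x)] => //.
exact: open_box.
Qed.

Lemma Cp_closure_near (Y : set (Cp X R)) f (e : R) (s : seq X) :
  closure Y f -> 0 < e ->
  exists2 g, Y g & forall x, x \in s -> `|f x - g x| < e.
Proof.
move=> Yf e0.
pose O := [set g : Cp X R | forall x, x \in s -> ball (f x) e (g x)].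
have /Yf[g [Yg sg]] : nbhs f O.
  apply: open_nbhs_nbhs; split; last by move=> x _; exact: ballxx.
  by apply: (@open_Cp_box s (fun x => ball (f x) e)) => x; exact: ball_open.
by exists g.
Qed.

End PointwiseConvergence.

(** * Implications between the selection principles *)

Section Selection.
Variable Z : topologicalType.

Lemma star1_star1_dense : star1 Z -> star1_dense Z.
Proof.
move=> star F Y finF dY; apply: star => // f _ n _ B.
rewrite nbhsE => -[U [oU Uf] UB].
have [g [Ug Yg]] := dY n U (ex_intro _ f Uf) oU.
by exists g; split=> //; exact: UB.
Qed.

(* The selections obtained for the finite sets [F k] exhausting a countable
   dense set, applied to the tails [Y (k + n)], are merged diagonally. *)
Lemma star1_dense_S_separable :
  separable_space Z -> star1_dense Z -> S_separable Z.
Proof.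
move=> [D /countable_injP[code code_inj] dD] star Y dY.
pose F k := D `&` [set d | (code d < k)%N].
have finF k : finite_set (F k).
  have: finite_set (code @` F k).
    by apply: sub_finite_set (finite_II k) => _ [d [_ dk] <-].
  rewrite (eq_finite_set (inj_card_eq _)) //.
  move=> x y /set_mem[Dx _] /set_mem[Dy _].
  by apply: code_inj; exact: mem_set.
have /choice[H HP] : forall k, exists H : nat -> set Z,
    finite_selection (fun n => Y (n + k)%N) H /\
    forall U, neighbourhood_of (F k) U ->
      exists n, forall x, F k x -> U x `&` H n !=set0.
  move=> k; have [//|n|H selH HU] := star (F k) (fun n => Y (n + k)%N).
    exact: dY.
  by exists H.
exists (fun n => \bigcup_(k in `I_n.+1) H k (n - k)%N).
  move=> n; split.
    by apply: bigcup_finite => // k _; have [/(_ (n - k)%N)[]] := HP k.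
  move=> z [k /= kn]; have [/(_ (n - k)%N)[_ /(_ z)] + _] := HP k.
  by rewrite subnK //; exact.
move=> G finG GP.
(* [m U] exceeds the code of some point of [D] in [U], so [F k] meets every member of [G] once [k]
   bounds all the [m U]. *)
have /choice[m mP] : forall U, exists m, G U ->
    exists x, [/\ D x, U x & (code x < m)%N].
  move=> U; have [/GP[oU U0]|nGU] := pselect (G U); last by exists 0%N.
  by have [x [Ux Dx]] := dD _ U0 oU; exists (code x).+1 => _; exists x.
have /finite_seqP[s Gs] : finite_set (m @` G) by exact: finite_image.
pose k := (\max_(i <- s) i)%N.
have mk U : G U -> (m U <= k)%N.
  move=> GU; have : (m @` G) (m U) by exists U.
  rewrite Gs => ms.
  exact: (@leq_bigmax_seq _ s xpredT id).
have [_ Hk] := HP k.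
(* Each [x] receives the intersection of the members of [G] containing it, so a selected point near
   [x] lies in all of them. *)
have [x Fx|n nH] := Hk (fun x => \bigcap_(U in G `&` [set U | U x]) U).
  split; last by move=> U [].
  apply: (@finite_bigcap_open _ _ _ id) => [|U [/GP[]//]].
  by apply: finite_setIl.
exists (n + k)%N => U GU.
have [x [Dx Ux xm]] := mP _ GU.
have [|y [yU Hy]] := nH x.
  by split=> //; exact: leq_trans (mk _ GU).
exists y; split; first exact: yU.
exists k; first by rewrite /= ltnS leq_addl.
by rewrite addnK.
Qed.

Lemma S_separable_M_separable : S_separable Z -> M_separable Z.
Proof.
move=> Ssep Y /Ssep[E selE denseE]; exists E => // O O0 oO.
have [|U -> //|n /(_ O erefl)[z [Oz Enz]]] := denseE [set O].
  exact: finite_set1.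
by exists z; split=> //; exists n.
Qed.

Lemma M_separable_separable : M_separable Z -> separable_space Z.
Proof.
move=> /(_ (fun=> setT))[_ O [z Oz] _|E selE dE]; first by exists z.
exists (\bigcup_n E n) => //; apply: bigcup_countable => // n _.
by apply: finite_set_countable; have [] := selE n.
Qed.

End Selection.

(** * From M-separability to Menger finite powers *)

Section FinitePowers.
Variables (R : realType) (X : topologicalType).

(** Functions separating single points of [s] from the complement of [U] are multiplied: one
    vanishing factor suffices on [s], and off [U] every factor is [1]. *)
Lemma completely_regular_seq_separator (U : set X) (s : seq X) :
  completely_regular_space X -> open U -> (forall x, x \in s -> U x) ->
  exists h : X -> R, [/\ continuous h, forall x, x \in s -> h x = 0 &
    forall x, ~ U x -> h x = 1].
Proof.
move=> crX oU; elim: s => [_|x s IHs sU].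
  by exists (cst 1); split => //; exact: cst_continuous.
have [|h [ch h0 h1]] := IHs.
  by move=> y ys; apply: sU; rewrite inE ys orbT.
have clU : closed (~` U) by rewrite closedC.
have nUx : ~ (~` U) x by apply; apply: sU; rewrite mem_head.
have [f [cf _ f0 f1]] := (@uniform_separatorP X R _ _).1 (crX x _ clU nUx).
exists (fun y => f y * h y); split=> [y|y|y nUy].
- by apply: continuousM; [exact: cf|exact: ch].
- rewrite inE => /predU1P[->|/h0 ->]; last by rewrite mulr0.
  have -> : f x = 0 by apply: f0; exists x.
  by rewrite mul0r.
- have -> : f y = 1 by apply: f1; exists y.
  by rewrite h1 // mul1r.
Qed.

(** Finitely many tuples have all entries in [s], and each has a box inside [O]. [N x] intersects
    all box sides at coordinates where a tuple takes the value [x]; [U] is the union of the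
    [N x]. *)
Lemma ptws_tube n (O : set {ptws 'I_n -> X}) (s : seq X) :
  open O -> (forall p : {ptws 'I_n -> X}, (forall i, p i \in s) -> O p) ->
  exists U : set X, [/\ open U, forall x, x \in s -> U x &
    forall p : {ptws 'I_n -> X}, (forall i, U (p i)) -> O p].
Proof.
move=> oO sO; pose T := {ffun 'I_n -> seq_sub s}.
pose pt (t : T) : {ptws 'I_n -> X} := fun i => ssval (t i).
have /choice[W WP] : forall t, exists W : 'I_n -> set X,
    (forall i, open_nbhs (pt t i) (W i)) /\
    forall p : {ptws 'I_n -> X}, (forall i, W i (p i)) -> O p.
  move=> t; have Ot : O (pt t) by apply: sO => i; exact: ssvalP.
  have [r [W tW rW]] := ptws_nbhs_box (open_nbhs_nbhs (conj oO Ot)).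
  by exists W; split=> // p Wp; apply: rW => i _; exact: Wp.
pose N (x : X) :=
  \bigcap_(ti in [set ti : T * 'I_n | pt ti.1 ti.2 = x]) W ti.1 ti.2.
exists (\bigcup_(x in [set` s]) N x); split.
- apply: bigcup_open => x _; apply: finite_bigcap_open => [|[t i] _ /=].
    exact: finite_finset.
  by have [/(_ i)[]] := WP t.
- move=> x xs; exists x => // -[t i] /= <-.
  by have [/(_ i)[]] := WP t.
- move=> p Np.
  (* A tuple [t] with [p i] in [N (t i)] for all [i] has [p] in its box. *)
  have /choice[t tP] : forall i, exists x : seq_sub s, N (ssval x) (p i).
    by move=> i; have [x xs Nx] := Np i; exists (SeqSub xs).
  have [_] := WP (finfun t); apply=> i.
  by apply: (tP i (finfun t, i)); rewrite /= /pt ffunE.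
Qed.

Lemma M_separable_menger n : completely_regular_space X ->
  M_separable (Cp X R) -> menger_space {ptws 'I_n -> X}.
Proof.
move=> crX Msep C oC.
pose good k (f : Cp X R) V := [/\ finite_set V, V `<=` C k &
  forall p : {ptws 'I_n -> X}, (forall i, f (p i) < 1) ->
    (\bigcup_(A in V) A) p].
have [k O [f Of] oO|E selE dE] :=
  Msep (fun k => [set f | exists V, good k f V]).
  have [s [e e0 sO]] := Cp_open_near oO Of.
  have [openC coverC] := oC k.
  (* One member of [C k] around each tuple from [s]: these form the finite family witnessing
     [good]. *)
  have /choice[A AP] : forall t : {ffun 'I_n -> seq_sub s}, exists A, C k A /\
      A ((fun i => ssval (t i)) : {ptws 'I_n -> X}).
    move=> t; have : [set: {ptws 'I_n -> X}] (fun i => ssval (t i)) by [].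
    by rewrite -coverC => -[A CA At]; exists A.
  have oA : open (\bigcup_(B in range A) B).
    by apply: bigcup_open => _ [t _ <-]; apply: openC; have [] := AP t.
  have [p ps|U [oU sU Up]] := ptws_tube (s := s) oA.
    pose t := [ffun i => SeqSub (ps i)].
    exists (A t); first by exists t.
    have [_] := AP t; congr (A t _).
    by apply/funext => i; rewrite ffunE.
  have [h [ch h0 h1]] := completely_regular_seq_separator crX oU sU.
  (* This combination equals [f] where [h = 0] and [1] where [h = 1], so it stays in [O] and is
     below [1] only inside [U]. *)
  have cg : continuous (fun x => f x * (1 - h x) + h x).
    move=> x; apply: cvgD; last exact: ch.
    apply: cvgM; first exact: cts_fun.
    by apply: cvgB; [exact: cvg_cst|exact: ch].
  exists (mkcts cg : continuousType X R); split.
    apply: sO => x xs.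
    by rewrite /= /mkcts h0 // subr0 mulr1 addr0 subrr normr0.
  exists (range A); split; first exact/finite_image/finite_finset.
    by move=> _ [t _ <-]; have [] := AP t.
  move=> p gp; apply: Up => i; apply: contrapT => nUp.
  by have := gp i; rewrite /= /mkcts h1 // subrr mulr0 add0r ltxx.
have /choice[V VP] : forall k, exists V, forall f, E k f -> good k f (V f).
  move=> k; have /choice[W WP] : forall f, exists W, E k f -> good k f W.
    move=> f; have [_ /(_ f) Ek] := selE k.
    by have [/Ek[W Wf]|nEf] := pselect (E k f); [exists W|exists set0].
  by exists W.
exists (fun k => \bigcup_(f in E k) V k f).
  move=> k; split.
    apply: bigcup_finite; first by have [] := selE k.
    by move=> f /VP[].
  by move=> A [f /VP[_ VC _] /VC].
rewrite -subTset => p _.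
pose O := [set g : Cp X R |
  forall x, x \in [seq p i | i <- enum 'I_n] -> [set y | y < 1] (g x)].
have [||f [Of [k _ Ekf]]] := dE O.
- exists (mkcts (@cst_continuous X R 0) : continuousType X R) => x _ /=.
  exact: ltr01.
- by apply: (@open_Cp_box R X _ (fun=> [set y | y < 1])) => _; exact: open_lt.
- exists k => //; have [_ _ /(_ p)[|A VA Ap]] := VP k f Ekf.
    by move=> i; apply: Of; apply: map_f; rewrite mem_enum.
  by exists A => //; exists f.
Qed.

End FinitePowers.

(** * From Menger finite powers to [star1] *)

Section MengerPowers.
Variables (R : realType) (X : topologicalType).
Implicit Types (F : set (Cp X R)) (Y : nat -> set (Cp X R)).

(** One set [near n g] fixes an approximation [g f] to every [f] in [F] at once, so a single index
    serves all of [F] at a given point [p]. As [F] is finite, finitely many members of the cover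
    yield finitely many functions. *)
Lemma menger_selection k F Y (e : nat -> R) :
  menger_space {ptws 'I_k -> X} -> finite_set F ->
  (forall n, F `<=` closure (Y n)) -> (forall n, 0 < e n) ->
  exists2 E, finite_selection Y E &
    forall p : 'I_k -> X, exists n, forall f, F f ->
      exists2 g, E n g & forall i, `|f (p i) - g (p i)| < e n.
Proof.
move=> mengerX finF FY e0.
pose near n (g : Cp X R -> Cp X R) : set {ptws 'I_k -> X} :=
  [set p | forall f, F f -> forall i, `|f (p i) - g f (p i)| < e n].
pose C n := [set near n g | g in [set g | forall f, F f -> Y n (g f)]].
have [n|V VC Vcover] := mengerX C.
  split.
    move=> _ [g _ <-].
    pose W (f : Cp X R) := [set x | `|f x - g f x| < e n].
    have oW f : open (W f).
      apply: (@open_comp _ _ (fun x => `|f x - g f x|) [set y | y < e n]).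
        by move=> x _; apply: cvg_norm; apply: cvgB; exact: cts_fun.
      exact: open_lt.
    rewrite (_ : near n g = \bigcap_(f in F) [set p : {ptws 'I_k -> X} |
        forall i, i \in enum 'I_k -> W f (p i)]).
      apply: finite_bigcap_open => // f _.
      exact: (@open_box _ _ (enum 'I_k) (fun=> W f)).
    apply/seteqP; split=> p pg f Ff; first by move=> i _; exact: pg.
    by move=> i; apply: pg => //; rewrite mem_enum.
  rewrite -subTset => p _.
  have /choice[g gP] : forall f, exists g, F f -> Y n g /\
      forall i, `|f (p i) - g (p i)| < e n.
    move=> f; have [Ff|] := pselect (F f); last by exists f.
    have [g Yg fg] :=
      Cp_closure_near [seq p i | i <- enum 'I_k] (FY n f Ff) (e0 n).
    by exists g => _; split=> // i; apply: fg; apply: map_f; rewrite mem_enum.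
  exists (near n g); last by move=> f /gP[].
  by exists g => // f /gP[].
have /choice[G GP] : forall n, exists G, forall A, V n A ->
    near n (G A) = A /\ forall f, F f -> Y n (G A f).
  move=> n; have /choice[G GP] : forall A, exists g, V n A ->
      near n g = A /\ forall f, F f -> Y n (g f).
    move=> A; have [/(proj2 (VC n))[g]|] := pselect (V n A); last by exists id.
    by exists g.
  by exists G.
exists (fun n => \bigcup_(A in V n) (G n A @` F)).
  move=> n; split.
    by apply: bigcup_finite => [|A _]; [have [] := VC n|exact: finite_image].
  by move=> _ [A VA [f Ff <-]]; have [_ GY] := GP n A VA; exact: GY.
move=> p; have : [set: {ptws 'I_k -> X}] p by [].
rewrite -Vcover => -[n _ [A VA Ap]]; exists n => f Ff.
exists (G n A f); first by exists A => //; exists f.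
have [nA _] := GP n A VA; have : near n (G n A) p by rewrite nA.
exact.
Qed.

(* A Menger selection only provides one good index for each point, so it is
   applied to the tails [Y (n + m)] to make the index large. *)
Lemma menger_star1 :
  (forall n, menger_space {ptws 'I_n -> X}) -> star1 (Cp X R).
Proof.
move=> mengerX F Y finF FY.
have /choice[H HP] : forall km : nat * nat, exists H,
    finite_selection (fun n => Y (n + km.2)%N) H /\
    forall p : 'I_km.1 -> X, exists n, forall f, F f -> exists2 g, H n g &
      forall i, `|f (p i) - g (p i)| < (n + km.2).+1%:R^-1.
  move=> [k m] /=.
  have [||H selH Hp] := menger_selection (e := fun n => (n + m).+1%:R^-1)
    (Y := fun n => Y (n + m)%N) (mengerX k) finF.
  - by move=> n f Ff; exact: FY.
  - by move=> n; rewrite invr_gt0.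
  - by exists H.
exists (fun n => \bigcup_(km in `I_n.+1 `*` `I_n.+1) H km (n - km.2)%N).
  move=> n; split.
    apply: bigcup_finite => [|km _]; first exact: finite_setX.
    by have [/(_ (n - km.2)%N)[]] := HP km.
  move=> g [km [/= _ kmn]]; have [/(_ (n - km.2)%N)[_ +] _] := HP km.
  by rewrite subnK //; exact.
move=> U FU.
(* Only the finitely many neighbourhoods [U f] with [f] in [F] count, so one list of points and one
   radius serve for all. *)
have [s [e e0 sU]] : exists s : seq X, exists2 e : R, 0 < e &
    forall f, F f -> forall g : Cp X R,
      (forall x, x \in s -> `|f x - g x| < e) -> U f g.
  have /finite_seqP[r Fr] := finF.
  have {}FU f : f \in r -> open (U f) /\ U f f.
    by move=> fr; apply: FU; rewrite Fr.
  rewrite {}Fr; elim: r FU => [|f r IHr] FU; first by exists [::], 1.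
  have [g gr|s [e e0 sU]] := IHr.
    by apply: FU; rewrite inE gr orbT.
  have [oU Uf] := FU f (mem_head _ _).
  have [s' [e' e'0 sU']] := Cp_open_near oU Uf.
  exists (s ++ s'), (Num.min e e'); first by rewrite lt_min e0.
  move=> f'; rewrite /= inE => /predU1P[->|fr] g gs.
    apply: sU' => x xs; rewrite distrC.
    by have := gs x; rewrite mem_cat xs orbT lt_min => /(_ isT)/andP[].
  apply: (sU f') => // x xs.
  by have := gs x; rewrite mem_cat xs lt_min => /(_ isT)/andP[].
have [m me] : exists m : nat, m.+1%:R^-1 < e.
  exists (Num.truncn e^-1); rewrite invf_plt ?posrE ?ltr0n //.
  exact: truncnS_gt.
(* The point of the power is [s] itself. The shift [size s + m] makes the final index at least
   [size s], as the diagonal union requires, and the error at most [1/(m+1)], below [e]. *)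
have [_ /(_ (tnth (in_tuple s)))[n nP]] := HP (size s, size s + m)%N.
exists (n + (size s + m))%N => f /[dup] Ff /nP[g Hg fg]; exists g; split.
  apply: (sU f) => // x /(tnthP (in_tuple s))[i ->].
  apply: lt_le_trans (fg i) _; apply: le_trans (ltW me).
  by rewrite lef_pV2 ?posrE ?ltr0n // ler_nat ltnS /= addnA leq_addl.
exists (size s, size s + m)%N; last by rewrite /= addnK.
by split; rewrite /= ltnS ?leq_addl // addnCA leq_addr.
Qed.

End MengerPowers.

(** * Separability of [Cp X R] and coarser second countable topologies *)

Lemma countable_surjection (T : Type) (A : set T) (t : T) : countable A ->
  exists u : nat -> T, forall a, A a -> exists n, u n = a.
Proof.
move=> /countable_injP[code code_inj].
(* [t] is the value at numbers that code no element of [A], so [A] may be empty. *)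
have /choice[u uP] : forall n, exists b, forall a, A a -> code a = n -> b = a.
  move=> n; have [[b Ab bn]|nA] := pselect (exists2 b, A b & code b = n).
    exists b => a Aa an; apply: code_inj; rewrite ?bn ?an //; exact: mem_set.
  by exists t => a Aa an; case: nA; exists a.
by exists u => a Aa; exists (code a); exact: uP.
Qed.

Section CoarserTopology.
Variables (R : realType) (X : topologicalType).

Lemma accessible_initial_topology (T : topologicalType) (f : X -> T) :
  injective f -> accessible_space T -> accessible_space (initial_topology f).
Proof.
move=> injf accT x y xy.
have [|A [oA /set_mem Ax /set_mem Ay]] := accT (f x) (f y).
  by apply: contra xy => /eqP/injf ->.
by exists (f @^-1` A); split; [exists A|exact: mem_set|exact: mem_set].
Qed.

Lemma second_countable_initial_topology (T : topologicalType) (f : X -> T) :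
  @second_countable T -> @second_countable (initial_topology f).
Proof.
move=> [B cB [oB nbhsB]]; exists [set f @^-1` b | b in B].
  exact: sub_countable (card_image_le _ _) cB.
split=> [_ [b Bb <-]|x A [_ [[C oC <-] Cfx CA]]].
  by exists b => //; exact: oB.
have [b [Bb bfx] bC] := nbhsB (f x) C (open_nbhs_nbhs (conj oC Cfx)).
exists (f @^-1` b); first by split; [exists b|].
by move=> y /bC; exact: CA.
Qed.

(** Boxes constraining finitely many coordinates to intervals with rational ends form a base, and
    finite lists code them. *)
Lemma second_countable_ptws : @second_countable {ptws nat -> R}.
Proof.
pose box (b : seq (nat * rat * rat)) : set {ptws nat -> R} :=
  \bigcap_(c in [set` b]) [set g | ratr c.1.2 < g c.1.1 < ratr c.2].
exists (range box).
  exact: sub_countable (card_image_le _ _) (countableP _).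
split.
  move=> _ [b _ <-]; apply: finite_bigcap_open => // -[[n p] q] _ /=.
  rewrite (_ : mkset _ =
      (fun g : {ptws nat -> R} => g n) @^-1` `]ratr p, ratr q[).
    apply: open_comp; last exact: itv_open.
    by move=> g _; exact: (@proj_continuous nat (fun=> R) n).
  by apply/seteqP; split=> g /=; rewrite in_itv.
move=> f A /ptws_nbhs_box[s [W fW sW]].
suff [b bf bA] : exists2 b, box b f &
    forall g, box b g -> forall i, i \in s -> W i (g i).
  by exists (box b); [split=> //; exists b|move=> g /bA; exact: sW].
elim: s {sW} => [|i s [b bf bs]]; first by exists [::] => // c.
have /nbhs_ballP[d /= d0 dW] := open_nbhs_nbhs (fW i).
have [|p] := @rat_in_itvoo R (f i - d) (f i); first by rewrite ltrBlDr ltrDl.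
rewrite in_itv /= => /andP[dp pf].
have [|q] := @rat_in_itvoo R (f i) (f i + d); first by rewrite ltrDl.
rewrite in_itv /= => /andP[fq qd].
exists ((i, p, q) :: b).
  move=> c; rewrite /= inE => /predU1P[->|/bf //].
  by rewrite /= pf.
move=> g bg j; rewrite inE => /predU1P[->|js]; last first.
  by apply: bs js => c cb; apply: bg; rewrite /= inE cb orbT.
have /andP[/= pg gq] := bg (i, p, q) (mem_head _ _).
by apply: dW; rewrite /ball /= ltr_norml; lra.
Qed.

(** Evaluating a countable dense set of functions maps [X] into a countable product of lines.
    Density makes this map [e] injective, and the topology it induces is the coarser one. *)
Lemma separable_iw_eq_omega :
  tychonoff_space X -> separable_space (Cp X R) -> iw_eq_omega X.
Proof.
move=> [accX crX] [D cD dD].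
have [d dP] := countable_surjection (mkcts (@cst_continuous X R 0) : Cp X R) cD.
pose e (x : X) : {ptws nat -> R} := fun n => d n x.
have inje : injective e.
  move=> x y exy; apply: contrapT => /eqP xy.
  have cly : closed [set y] by exact: accessible_closed_set1.
  have [f [cf _ f0 f1]] :=
    (@uniform_separatorP X R _ _).1 (crX x _ cly (elimN eqP xy)).
  have fx : f x = 0 by apply: f0; exists x.
  have fy : f y = 1 by apply: f1; exists y.
  (* [W] asks for a value below [1/2] at [x] and above [1/2] at [y]; some [d n] has such values,
     against [e x = e y]. *)
  pose W z : set R := if z == x then [set r | r < 2^-1] else [set r | 2^-1 < r].
  have oW z : open (W z).
    by rewrite /W; case: ifP => _; [exact: open_lt|exact: open_gt].
  have [||g [sg /dP[n dg]]] :=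
    dD [set g : Cp X R | forall z, z \in [:: x; y] -> W z (g z)].
  - exists (mkcts cf : Cp X R) => z; rewrite !inE /W => /orP[] /eqP -> /=.
      by rewrite eqxx /= /mkcts fx; lra.
    by rewrite eq_sym (negbTE xy) /= /mkcts fy; lra.
  - exact: open_Cp_box.
  have := sg x; have := sg y.
  rewrite !inE /W eqxx eq_sym (negbTE xy) eqxx orbT -dg /=.
  move=> /(_ isT) + /(_ isT).
  by have -> : d n x = d n y := congr1 (fun u => u n) exy; lra.
exists (Topological.class (initial_topology e)); split.
- split.
    apply: accessible_initial_topology => //; apply: hausdorff_accessible.
    by apply: (@hausdorff_product nat (fun=> R)) => _; exact: Rhausdorff.
  (* A topology induced from a uniform space is uniform, hence completely regular. *)
  exact: (@uniform_completely_regular R (initial_topology e)).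
- move=> U [V oV <-]; apply: open_comp => // x _.
  apply/cvg_sup => n A [_ [[B oB <-] Bx BA]]; apply: filterS BA _.
  by apply: (@cts_fun _ _ (d n) x B); exact: open_nbhs_nbhs.
- exact: second_countable_initial_topology second_countable_ptws.
Qed.

(** The value [1] on a whole basic set, not just at [x], ties the function to the pair [U], [V]
    instead of to a point. With [V] basic too, countably many such functions suffice. *)
Lemma second_countable_bump (X' : topologicalType) (B : set (set X'))
    (V : set X') x :
  completely_regular_space X' -> basis B -> open V -> V x ->
  exists2 U, B U /\ U x & exists h : X' -> R, [/\ continuous h,
    forall y, U y -> h y = 1 & forall y, ~ V y -> h y = 0].
Proof.
move=> crX [oB nbhsB] oV Vx.
have clV : closed (~` V) by rewrite closedC.
have nVx : ~ (~` V) x by apply.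
have [h [ch _ h0 h1]] := (@uniform_separatorP X' R _ _).1 (crX x _ clV nVx).
have hx : h x = 0 by apply: h0; exists x.
have [|U BUx hU] := nbhsB x (h @^-1` [set r | r < 2^-1]).
  apply: open_nbhs_nbhs; split; last by rewrite /= hx; lra.
  by apply: open_comp => [y _|]; [exact: ch|exact: open_lt].
(* This function is [1] where [h <= 1/2] and [0] where [h = 1]. *)
exists U => //; exists (fun y => 3 / 2 - h y - `|h y - 2^-1|).
split=> [y|y /hU /= hy|y Vy].
- apply: cvgB; first by apply: cvgB; [exact: cvg_cst|exact: ch].
  by apply: cvg_norm; apply: cvgB; [exact: ch|exact: cvg_cst].
- by rewrite ltr0_norm; lra.
- have -> : h y = 1 by apply: h1; exists y.
  by rewrite ger0_norm; lra.
Qed.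

(** Fix a bump function for each pair of basic sets admitting one. Their finite rational
    combinations are countably many, and dense because bumps isolating each of finitely many points
    approximate any values there. *)
Lemma iw_eq_omega_separable : iw_eq_omega X -> separable_space (Cp X R).
Proof.
move=> [c [[accX crX] coarser [B cB basisB]]].
have [b bP] := countable_surjection set0 cB.
set X' := Topological.Pack c in accX crX coarser basisB.
pose bump (ij : nat * nat) (g : Cp X R) :=
  (forall y, b ij.1 y -> g y = 1) /\ (forall y, ~ b ij.2 y -> g y = 0).
(* The zero function is a placeholder for pairs without a bump function. *)
have /choice[g gP] : forall ij, exists g, (exists h, bump ij h) -> bump ij g.
  move=> ij; have [[h hij]|nex] := pselect (exists h, bump ij h).
    by exists h.
  by exists (mkcts (@cst_continuous X R 0)).
pose comb (l : seq (rat * (nat * nat))) (x : X) : R :=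
  \sum_(t <- l) ratr t.1 * g t.2 x.
have ccomb l : continuous (comb l).
  elim: l => [|t l IHl].
    rewrite (_ : comb [::] = cst 0); first exact: cst_continuous.
    by apply/funext => x; rewrite /comb big_nil.
  rewrite (_ : comb (t :: l) = fun x => ratr t.1 * g t.2 x + comb l x).
    move=> x; apply: cvgD; last exact: IHl.
    by apply: cvgM; [exact: cvg_cst|exact: cts_fun].
  by apply/funext => x; rewrite /comb big_cons.
exists (range (fun l => mkcts (ccomb l) : Cp X R)).
  exact: sub_countable (card_image_le _ _) (countableP _).
move=> O [f Of] oO.
(* Repetitions are removed so that each point contributes a single term to the sum. *)
have [s' [e e0 sO]] := Cp_open_near oO Of; pose s := undup s'.
have /choice[t tP] : forall x, exists t : rat * (nat * nat), x \in s ->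
    [/\ `|ratr t.1 - f x| < e, g t.2 x = 1 &
      forall y, y \in s -> y != x -> g t.2 y = 0].
  move=> x; have [xs|] := boolP (x \in s); last by exists (0, (0%N, 0%N)).
  have [|q] := @rat_in_itvoo R (f x) (f x + e); first by rewrite ltrDl.
  rewrite in_itv /= => /andP[fq qe].
  (* A basic set around [x] avoiding the other points of [s], where the bump will then vanish. *)
  have [V [BV Vx] sV] : filter_from [set V | B V /\ V x] id
      (\bigcap_(y in [set` rem x s]) (~` [set y]) : set X').
    apply: basisB.2; apply: open_nbhs_nbhs; split.
      apply: finite_bigcap_open => // y _; rewrite openC.
      exact: accessible_closed_set1.
    move=> y /=; rewrite mem_rem_uniq ?undup_uniq //.
    by move=> /andP[/eqP yx _] /esym.
  have [U [BU Ux] [h [ch hU hV]]] :=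
    second_countable_bump crX basisB (basisB.1 _ BV) Vx.
  have [i bi] := bP _ BU; have [j bj] := bP _ BV.
  have chX : continuous (h : X -> R).
    by apply/continuousP => A oA; apply: coarser; move/continuousP: ch; exact.
  have [gU gV] : bump (i, j) (g (i, j)).
    apply: gP; exists (mkcts chX).
    by split=> /= y; rewrite ?bi ?bj; [exact: hU|exact: hV].
  exists (q, (i, j)) => _; split=> [||y ys yx] /=.
  - by rewrite ger0_norm; lra.
  - by apply: gU; rewrite /= bi.
  - apply: gV; rewrite /= bj => /sV/(_ y); apply => //=.
    by rewrite mem_rem_uniq ?undup_uniq // inE yx.
exists (mkcts (ccomb (map t s)) : Cp X R); split; last by exists (map t s).
apply: sO => x; rewrite -mem_undup -/s => xs; rewrite /= /mkcts /comb big_map.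
have [qx gx _] := tP x xs.
(* At [x] only its own term survives, a rational within [e] of [f x]. *)
rewrite (bigD1_seq x) ?undup_uniq //= gx mulr1 big_seq_cond big1 ?addr0 //.
move=> y /andP[ys yx]; have [_ _ /(_ x xs)] := tP y ys.
by rewrite eq_sym => /(_ yx) ->; rewrite mulr0.
Qed.

End CoarserTopology.

(** * The cycle of implications between the five conditions *)

Theorem theorem3p30 (R : realType) (X : topologicalType)
    (tychonoffX : tychonoff_space X) :
  [<-> separable_space (Cp X R) /\ star1 (Cp X R);
       separable_space (Cp X R) /\ star1_dense (Cp X R);
       S_separable (Cp X R);
       M_separable (Cp X R);
       iw_eq_omega X /\ forall n : nat, menger_space {ptws 'I_n -> X}].
Proof.
tfae.
- by move=> [sepX starX]; split=> //; exact: star1_star1_dense.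
- by move=> [sepX starX]; exact: star1_dense_S_separable.
- exact: S_separable_M_separable.
- move=> MsepX; split; last first.
    by move=> n; apply: M_separable_menger MsepX; case: tychonoffX.
  exact: separable_iw_eq_omega (M_separable_separable MsepX).
- move=> [iwX mengerX]; split; first exact: iw_eq_omega_separable.
  exact: menger_star1.
Qed.
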